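(* Let $n\ge2$, let $A,B_1,\ldots,B_n,C_1,\ldots,C_n\in\widehat{\mathbb F_q}$ and $x_1,\ldots,x_n\in\mathbb F_q$. Let $k,l\in\{1,\ldots,n\}$ with $k\neq l$ and $x_l\ne0$. Then $$\begin{aligned}F_A^{(n)}&\left[A;B_1,\ldots,B_n;C_1,\ldots,C_n\mid x_1,\ldots,x_n\right]\\&=\frac{B_kC_k(-1)}{q}\,\overline{B_k}C_k(x_k-1)\,\overline{C_k}(x_k)\,\overline{A}(-x_l)\,C_l(-1)\;F_A^{(n-1)}\left[A;(B_i')_{i\ne k};(C_i)_{i\neq k}\mid (y_i)_{i\neq k}\right]\\&\quad+\frac{B_kC_k(-1)\,\overline{C_k}(x_k)}{q}\sum_{t_k\in\mathbb F_q}A\overline{C_k}(t_k)\,B_k(t_k-1)\,\overline{B_k}C_k(1-t_k+x_kt_k)\;F_A^{(n-1)}\left[A;(B_i)_{i\ne k};(C_i)_{i\ne k}\mid (x_it_k)_{i\ne k}\right],\end{aligned}$$ where $B_l'=\overline{B_l}C_l$ and $B_i'=B_i$ for $i\ne k,l$, while $y_l=1$ and $y_i=-x_i/x_l$ for $i\neq k,l$, and all lists $(\cdot)_{i\ne k}$ are indexed by $i\in\{1,\ldots,n\}\setminus\{k\}$ in increasing order.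
   Context: Let $p$ be an odd prime, $q=p^r$ with $r\ge1$, and $\mathbb F_q$ the field with $q$ elements. $\widehat{\mathbb F_q}$ is the group of multiplicative characters $\chi:\mathbb F_q^\times\to\mathbb C^\times$, each extended to $\mathbb F_q$ by $\chi(0)=0$ (including the trivial character $\epsilon$, so $\epsilon(0)=0$ and $\epsilon(x)=1$ for $x\neq0$). $\overline{\chi}$ is the inverse of $\chi$, and products of characters are pointwise, e.g. $\overline{B}C(x)=\overline{B}(x)C(x)$. For each $m\ge1$ the finite field Lauricella series is (the subscript $A$ in $F_A^{(m)}$ is part of the name) $$F_A^{(m)}\left[A;B_1,\ldots,B_m;C_1,\ldots,C_m\mid x_1,\ldots,x_m\right]=\sum_{t_1,\ldots,t_m\in\mathbb F_q}\left(\prod_{i=1}^m\epsilon(x_i)\frac{B_iC_i(-1)}{q}B_i(t_i)\overline{B_i}C_i(1-t_i)\right)\overline{A}(1-x_1t_1-\cdots-x_mt_m).$$ *)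

(* Defs.v *)
From HB Require Import structures.
From mathcomp Require Import all_boot all_order all_fingroup all_algebra.
From mathcomp Require Import boolp reals complex.

Set Implicit Arguments.
Unset Strict Implicit.
Unset Printing Implicit Defensive.

Import GRing.Theory.
Local Open Scope ring_scope.

(* A multiplicative character of F: a homomorphism from the unit group of F to
   the nonzero complex numbers; the field of complex numbers is R[i] with
   R : realType. *)
Record mulchar (R : realType) (F : finFieldType) := MulChar {
  mulchar_unit : {unit F} -> R[i];
  mulchar_neq0 : forall u, mulchar_unit u != 0;
  mulcharM : {morph mulchar_unit : u v / (u * v)%g >-> u * v} }.

(* Extension by 0 at the only non-unit of F. *)
Definition mulchar_ext (R : realType) (F : finFieldType) (chi : mulchar R F)
    (x : F) : R[i] :=
  if insub x is Some u then mulchar_unit chi u else 0.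

Coercion mulchar_ext : mulchar >-> Funclass.

Section MulCharGroup.
Variables (R : realType) (F : finFieldType).
Implicit Types chi psi : mulchar R F.

Lemma mulchar_eqP chi psi : mulchar_unit chi =1 mulchar_unit psi -> chi = psi.
Proof.
case: chi psi => [f f0 fM] [g g0 gM] /= /funext fg.
rewrite fg in f0 fM *; congr MulChar; exact: Prop_irrelevance.
Qed.

Fact mulchar_one_neq0 (u : {unit F}) : (1 : R[i]) != 0.
Proof. exact: oner_neq0. Qed.

Fact mulchar_one_morph :
  {morph (fun=> 1) : u v / (u * v : {unit F})%g >-> (u * v : R[i])}.
Proof. by move=> u v; rewrite mulr1. Qed.

Definition mulchar_one : mulchar R F :=
  MulChar mulchar_one_neq0 mulchar_one_morph.

Fact mulchar_mul_neq0 chi psi u : mulchar_unit chi u * mulchar_unit psi u != 0.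
Proof. by rewrite mulf_neq0 ?mulchar_neq0. Qed.

Fact mulchar_mul_morph chi psi :
  {morph (fun u => mulchar_unit chi u * mulchar_unit psi u)
    : u v / (u * v)%g >-> u * v}.
Proof. by move=> u v; rewrite !mulcharM mulrACA. Qed.

Definition mulchar_mul chi psi : mulchar R F :=
  MulChar (mulchar_mul_neq0 chi psi) (mulchar_mul_morph chi psi).

Fact mulchar_inv_neq0 chi u : (mulchar_unit chi u)^-1 != 0.
Proof. by rewrite invr_neq0 ?mulchar_neq0. Qed.

Fact mulchar_inv_morph chi :
  {morph (fun u => (mulchar_unit chi u)^-1) : u v / (u * v)%g >-> u * v}.
Proof. by move=> u v; rewrite mulcharM invfM. Qed.

Definition mulchar_inv chi : mulchar R F :=
  MulChar (mulchar_inv_neq0 chi) (mulchar_inv_morph chi).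

HB.instance Definition _ := gen_eqMixin (mulchar R F).
HB.instance Definition _ := gen_choiceMixin (mulchar R F).

Fact mulchar_mulA : associative mulchar_mul.
Proof. by move=> a b c; apply: mulchar_eqP => u /=; rewrite mulrA. Qed.

Fact mulchar_mul1 : left_id mulchar_one mulchar_mul.
Proof. by move=> a; apply: mulchar_eqP => u /=; rewrite mul1r. Qed.

Fact mulchar_mulr1 : right_id mulchar_one mulchar_mul.
Proof. by move=> a; apply: mulchar_eqP => u /=; rewrite mulr1. Qed.

Fact mulchar_mulV : left_inverse mulchar_one mulchar_inv mulchar_mul.
Proof.
by move=> a; apply: mulchar_eqP => u /=; rewrite mulVf ?mulchar_neq0.
Qed.

Fact mulchar_mulrV : right_inverse mulchar_one mulchar_inv mulchar_mul.
Proof.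
by move=> a; apply: mulchar_eqP => u /=; rewrite divff ?mulchar_neq0.
Qed.

HB.instance Definition _ := isGroup.Build (mulchar R F)
  mulchar_mulA mulchar_mul1 mulchar_mulr1 mulchar_mulV mulchar_mulrV.

Lemma mulchar_ext1 (x : F) : (1%g : mulchar R F) x = (x != 0)%:R.
Proof.
rewrite /mulchar_ext; case: insubP => [u|]; rewrite unitfE; first by move=> ->.
by move/negbTE=> ->.
Qed.

Lemma mulchar_extM chi psi (x : F) : (chi * psi)%g x = chi x * psi x.
Proof. by rewrite /mulchar_ext; case: insub => //; rewrite mul0r. Qed.

Lemma mulchar_extV chi (x : F) : (chi^-1)%g x = (chi x)^-1.
Proof. by rewrite /mulchar_ext; case: insub => //; rewrite invr0. Qed.

End MulCharGroup.

(* The trivial character epsilon is 1%g; products and inverses of characters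
   are taken in the group mulchar R F. *)
Definition lauricellaA (R : realType) (F : finFieldType) (m : nat)
    (A : mulchar R F) (B C : 'I_m -> mulchar R F) (x : 'I_m -> F) : R[i] :=
  \sum_(t : {ffun 'I_m -> F})
    (\prod_(i < m) ((1%g : mulchar R F) (x i)
                    * ((B i * C i)%g (-1) / #|F|%:R)
                    * B i (t i)
                    * ((B i)^-1 * C i)%g (1 - t i)))
    * (A^-1)%g (1 - \sum_(i < m) x i * t i).

(* Main.v *)
(* Isolate the sum over t_k and put s = sum_(i != k) x_i t_i.  The substitution
   t = 1 / (1 - x_k t_k) turns the terms with t_k != 1 / x_k into the sum over t
   of the second summand.  The remaining terms t_k = 1 / x_k carry the factor
   A^-1 (- s); they form the first summand after the reflection
   t_l |-> 1 - t_l and division of - s by - x_l. *)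
Require Import Defs.
From mathcomp Require Import all_boot all_order all_fingroup all_algebra.
From mathcomp Require Import boolp reals complex.
From mathcomp Require Import ring.

Set Implicit Arguments.
Unset Strict Implicit.
Unset Printing Implicit Defensive.

Import GRing.Theory.
Local Open Scope ring_scope.

Section MulCharTheory.
Variables (R : realType) (F : finFieldType).
Implicit Types (chi A B C : mulchar R F) (s t x y : F).

Lemma mulchar0 chi : chi 0 = 0.
Proof. by rewrite /mulchar_ext insubF // unitr0. Qed.

Lemma mulchar_mulr chi : {morph chi : x y / x * y}.
Proof.
move=> x y; have [->|x0] := eqVneq x 0; first by rewrite mul0r mulchar0 mul0r.
have [->|y0] := eqVneq y 0; first by rewrite mulr0 mulchar0 mulr0.
rewrite /mulchar_ext; case: insubP => [w _ wE|]; last first.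
  by rewrite unitfE mulf_neq0.
case: insubP => [u _ uE|]; last by rewrite unitfE x0.
case: insubP => [v _ vE|]; last by rewrite unitfE y0.
by rewrite -mulcharM; congr mulchar_unit; apply: val_inj; rewrite /= wE uE vE.
Qed.

Lemma mulchar_eq0 chi x : (chi x == 0) = (x == 0).
Proof.
have [->|x0] := eqVneq x 0; first by rewrite mulchar0 eqxx.
rewrite /mulchar_ext; case: insubP => [u _ _|]; last by rewrite unitfE x0.
exact/negbTE/mulchar_neq0.
Qed.

Lemma mulchar1r chi : chi 1 = 1.
Proof.
have chi1 : chi 1 != 0 by rewrite mulchar_eq0 oner_eq0.
by apply: (mulfI chi1); rewrite -mulchar_mulr !mulr1.
Qed.

Lemma mulcharVr chi x : chi x^-1 = (chi x)^-1.
Proof.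
have [->|x0] := eqVneq x 0; first by rewrite invr0 mulchar0 invr0.
have cx : chi x != 0 by rewrite mulchar_eq0.
by apply: (mulfI cx); rewrite -mulchar_mulr !mulfV // mulchar1r.
Qed.

Lemma mulcharN1_inv chi : (chi (-1))^-1 = chi (-1).
Proof. by rewrite -mulcharVr invrN1. Qed.

Lemma mulcharN1_sqr chi : chi (-1) * chi (-1) = 1.
Proof. by rewrite -mulchar_mulr mulrNN mulr1 mulchar1r. Qed.

(** One factor of the product in [lauricellaA], written so that unfolding it gives back that product
    by conversion. *)
Definition lauricella_weight B C x t : R[i] :=
  (1%g : mulchar R F) x * ((B * C)%g (-1) / #|F|%:R) * B t
  * (B^-1 * C)%g (1 - t).

(** [x] enters only through the trivial character, so arguments may be rescaled by a nonzero
    constant without changing the weight. *)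
Lemma lauricella_weight_eps B C x y t : (x == 0) = (y == 0) ->
  lauricella_weight B C x t = lauricella_weight B C y t.
Proof. by rewrite /lauricella_weight !mulchar_ext1 => ->. Qed.

(** Replacing B by B^-1 C swaps the factors at t and 1 - t, as (B^-1 C)^-1 C = B; the sign arises
    because (B C)(-1) becomes (B^-1 C C)(-1) = B(-1). *)
Lemma lauricella_weight_refl B C x t :
  lauricella_weight (B^-1 * C)%g C x (1 - t)
  = C (-1) * lauricella_weight B C x t.
Proof.
rewrite /lauricella_weight !mulchar_extM !mulchar_extV !mulcharN1_inv.
rewrite mulchar_extM mulchar_extV invfM invrK subKr.
have [->|t0] := eqVneq t 0; first by rewrite !mulchar0; ring.
have Ct : C t != 0 by rewrite mulchar_eq0.
have -> : (B t * (C t)^-1 * C t) = B t by rewrite mulfVK.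
have -> : B (-1) * C (-1) * C (-1) = C (-1) * (B (-1) * C (-1)) by ring.
ring.
Qed.

(** The sum over t_k alone, with s the contribution of the other variables. If t = 1 / (1 - x u),
    then 1 - (x u + s) = (1 - t s) / t, so s comes out scaled by t. *)
Lemma lauricella_resum A B C x s : x != 0 ->
  \sum_t B t * (B^-1 * C)%g (1 - t) * (A^-1)%g (1 - (x * t + s))
  = (C^-1)%g x *
    ((B^-1 * C)%g (x - 1) * (A^-1)%g (- s)
     + \sum_t (A * C^-1)%g t * B (t - 1) * (B^-1 * C)%g (1 - t + x * t)
              * (A^-1)%g (1 - t * s)).
Proof.
move=> x0.
(* The point 1/x, where the substitution has a pole, is split off on the left; on the right the term
   at 0 vanishes. *)
rewrite (bigD1 x^-1) //= [in RHS](bigD1 0) //=.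
rewrite (mulchar0 (A * C^-1)%g) !mul0r add0r.
rewrite mulrDr; congr (_ + _).
  rewrite divff // opprD addNKr.
  have -> : 1 - x^-1 = x^-1 * (x - 1) by field.
  rewrite mulchar_mulr !mulchar_extM !mulchar_extV !mulcharVr invrK.
  have Bx : B x != 0 by rewrite mulchar_eq0.
  have Cx : C x != 0 by rewrite mulchar_eq0.
  (* These character values may be 0, so their inverses are kept as atoms for [field]. *)
  set a := (A _)^-1; set b := (B (x - 1))^-1.
  by field; rewrite Bx Cx.
(* Since [0^-1 = 0], the two maps are mutually inverse on all of F and match u = 1/x with t = 0, so
   u != 1/x becomes t != 0. *)
rewrite (reindex_onto (fun t => (1 - t^-1) / x)
  (fun u => (1 - x * u)^-1)) /=; last first.
  move=> u ux; rewrite invrK; have -> : 1 - (1 - x * u) = u * x by ring.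
  by rewrite mulfK.
rewrite big_distrr /=; apply: eq_big => [t|t].
  have -> : 1 - x * ((1 - t^-1) / x) = t^-1.
    by rewrite mulrCA divff // mulr1 subKr.
  rewrite invrK eqxx andbT -subr_eq0.
  have -> : (1 - t^-1) / x - x^-1 = - (t^-1 / x) by ring.
  by rewrite oppr_eq0 mulf_eq0 !invr_eq0 (negbTE x0) orbF.
have -> : 1 - x * ((1 - t^-1) / x) = t^-1.
  by rewrite mulrCA divff // mulr1 subKr.
rewrite invrK eqxx andbT -subr_eq0.
have -> : (1 - t^-1) / x - x^-1 = - (t^-1 / x) by ring.
rewrite oppr_eq0 mulf_eq0 !invr_eq0 (negbTE x0) orbF => t0.
have -> : (1 - t^-1) / x = (t - 1) * (t^-1 * x^-1) by field; rewrite x0.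
have -> : 1 - (t - 1) * (t^-1 * x^-1) = (1 - t + x * t) * (t^-1 * x^-1).
  by field; rewrite t0 x0.
have -> : 1 - (x * ((t - 1) * (t^-1 * x^-1)) + s) = (1 - t * s) * t^-1.
  by field; rewrite t0 x0.
rewrite !mulchar_extM !mulchar_mulr !mulchar_extV !mulcharVr.
have [Bt Bx] : B t != 0 /\ B x != 0 by rewrite !mulchar_eq0.
have [Ct Cx] : C t != 0 /\ C x != 0 by rewrite !mulchar_eq0.
rewrite !invrK; set b := (B (1 - t + _))^-1; set a := (A (1 - _))^-1.
by field; rewrite Bt Bx Ct Cx.
Qed.

End MulCharTheory.

Section Lauricella.
Variables (R : realType) (F : finFieldType).
Implicit Types (A : mulchar R F) (m : nat).

Lemma lauricellaA_weight m A (B C : 'I_m -> mulchar R F) (x : 'I_m -> F) :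
  lauricellaA A B C x
  = \sum_(t : {ffun 'I_m -> F})
      (\prod_(i < m) lauricella_weight (B i) (C i) (x i) (t i))
      * (A^-1)%g (1 - \sum_(i < m) x i * t i).
Proof. by []. Qed.

(** A tuple amounts to its entry [a] at k together with the tuple [f] of the others; [unlift k i] is
    [None] exactly at i = k, where [oapp] returns [a]. *)
Lemma sum_ffun_lift m (k : 'I_m.+1) (G : {ffun 'I_m.+1 -> F} -> R[i]) :
  \sum_t G t
  = \sum_(f : {ffun 'I_m -> F}) \sum_a G [ffun i => oapp f a (unlift k i)].
Proof.
rewrite pair_big /=.
rewrite (reindex (fun p : {ffun 'I_m -> F} * F =>
  [ffun i => oapp p.1 p.2 (unlift k i)])) //=.
exists (fun t : {ffun 'I_m.+1 -> F} => ([ffun j => t (lift k j)], t k)).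
  move=> [f a] _ /=; congr (_, _); last by rewrite ffunE unlift_none.
  by apply/ffunP=> j; rewrite !ffunE liftK.
move=> t _; apply/ffunP=> i; rewrite ffunE /=.
by case: unliftP => [j ->|->] //=; rewrite ffunE.
Qed.

Lemma lauricellaA_split m A (B C : 'I_m.+1 -> mulchar R F) (x : 'I_m.+1 -> F)
    (k : 'I_m.+1) :
  lauricellaA A B C x
  = \sum_(f : {ffun 'I_m -> F})
      (\prod_(j < m) lauricella_weight (B (lift k j)) (C (lift k j))
                       (x (lift k j)) (f j))
      * \sum_a lauricella_weight (B k) (C k) (x k) a
               * (A^-1)%g (1 - (x k * a + \sum_(j < m) x (lift k j) * f j)).
Proof.
rewrite lauricellaA_weight (sum_ffun_lift k); apply: eq_bigr => f _.
rewrite big_distrr; apply: eq_bigr => a _ /=.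
rewrite !(bigD1_ord k) //= !ffunE unlift_none /= -mulrA mulrCA.
congr (_ * (_ * (A^-1)%g (1 - (_ + _)))).
  by apply: eq_bigr => j _; rewrite ffunE liftK.
by apply: eq_bigr => j _; rewrite ffunE liftK.
Qed.

(** With t_l = 1 - u, the sum - sum_i x_i t_i equals - x_l (1 - u - sum_(i != l) (- x_i / x_l) t_i),
    which has the shape of the argument of A^-1 in a series. *)
Lemma lauricellaA_reflect m A (B C : 'I_m -> mulchar R F) (x : 'I_m -> F)
    (l : 'I_m) : x l != 0 ->
  (A^-1)%g (- x l) * C l (-1)
  * lauricellaA A (fun i => if i == l then ((B l)^-1 * C l)%g else B i) C
      (fun i => if i == l then 1 else - x i / x l)
  = \sum_(t : {ffun 'I_m -> F})
      (\prod_(i < m) lauricella_weight (B i) (C i) (x i) (t i))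
      * (A^-1)%g (- \sum_(i < m) x i * t i).
Proof.
move=> xl; rewrite lauricellaA_weight.
pose h (t : {ffun 'I_m -> F}) := [ffun i => if i == l then 1 - t i else t i].
have hK : involutive h.
  move=> t; apply/ffunP=> i; rewrite !ffunE.
  by case: eqP => // _; rewrite subKr.
rewrite (reindex_inj (inv_inj hK)) big_distrr /=; apply: eq_bigr => t _.
rewrite [in LHS](bigD1 l) //= [\prod_(i < m) _ in RHS](bigD1 l) //= ffunE eqxx.
rewrite lauricella_weight_refl.
rewrite (@lauricella_weight_eps _ _ _ _ 1 (x l)); last first.
  by rewrite (negbTE xl) oner_eq0.
have -> : \prod_(i < m | i != l)
    lauricella_weight (if i == l then ((B l)^-1 * C l)%g else B i) (C i)
      (if i == l then 1 else - x i / x l) (h t i)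
  = \prod_(i < m | i != l) lauricella_weight (B i) (C i) (x i) (t i).
  apply: eq_bigr => i /negbTE il; rewrite ffunE il.
  apply: lauricella_weight_eps.
  by rewrite mulf_eq0 oppr_eq0 invr_eq0 (negbTE xl) orbF.
have -> : - \sum_(i < m) x i * t i
  = - x l * (1 - \sum_(i < m) (if i == l then 1 else - x i / x l) * h t i).
  rewrite (bigD1 l) //= [in RHS](bigD1 l) //= ffunE eqxx mul1r.
  have -> : \sum_(i < m | i != l) x i * t i = - x l *
      \sum_(i < m | i != l) (if i == l then 1 else - x i / x l) * h t i.
    rewrite big_distrr /=; apply: eq_bigr => i /negbTE il.
    by rewrite ffunE il; field.
  ring.
(* The sign C_l(-1) from the reflected weight cancels the one in the statement. *)
have CC := mulcharN1_sqr (C l).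
rewrite mulchar_mulr -[RHS]mul1r -CC; ring.
Qed.

End Lauricella.

(* lift k : 'I_n.-1 -> 'I_n is the increasing enumeration of the indices
   different from k. *)
Theorem theorem3p3 (R : realType) (p r : nat) (F : finFieldType)
    (hp : prime p) (podd : odd p) (hr : (1 <= r)%N) (hF : #|F| = (p ^ r)%N)
    (n : nat) (hn : (2 <= n)%N)
    (A : mulchar R F) (B C : 'I_n -> mulchar R F) (x : 'I_n -> F)
    (k l : 'I_n) (hkl : k != l) (hxl : x l != 0) :
  lauricellaA A B C x =
    (B k * C k)%g (-1) / #|F|%:R
    * ((B k)^-1 * C k)%g (x k - 1) * ((C k)^-1)%g (x k)
    * (A^-1)%g (- x l) * C l (-1)
    * lauricellaA A
        (fun j : 'I_n.-1 => if lift k j == l then ((B l)^-1 * C l)%g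
                            else B (lift k j))
        (fun j : 'I_n.-1 => C (lift k j))
        (fun j : 'I_n.-1 => if lift k j == l then 1
                            else - x (lift k j) / x l)
    + (B k * C k)%g (-1) * ((C k)^-1)%g (x k) / #|F|%:R
      * \sum_(t : F)
          (A * (C k)^-1)%g t * B k (t - 1)
          * ((B k)^-1 * C k)%g (1 - t + x k * t)
          * lauricellaA A
              (fun j : 'I_n.-1 => B (lift k j))
              (fun j : 'I_n.-1 => C (lift k j))
              (fun j : 'I_n.-1 => x (lift k j) * t).
Proof.
case: n hn B C x k l hkl hxl => // m _ B C x k l kl xl.
(* [j0] is the position of l in the list with k removed. *)
case/unlift_some: kl xl => j0 -> _ xl.
rewrite (lauricellaA_split _ _ _ _ k).
(* If x_k = 0, the left side vanishes through the trivial character at x_k, and the right side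
   through C_k^-1(x_k). *)
have [xk|xk] := eqVneq (x k) 0.
  rewrite xk mulchar0 !mulr0 !mul0r addr0; apply: big1 => f _.
  rewrite [X in _ * X]big1 ?mulr0 // => a _.
  by rewrite /lauricella_weight mulchar0 !mul0r.
have sumE s : \sum_a lauricella_weight (B k) (C k) (x k) a
                    * (A^-1)%g (1 - (x k * a + s))
    = (B k * C k)%g (-1) / #|F|%:R * ((C k)^-1)%g (x k) *
    (((B k)^-1 * C k)%g (x k - 1) * (A^-1)%g (- s)
     + \sum_t (A * (C k)^-1)%g t * B k (t - 1)
              * ((B k)^-1 * C k)%g (1 - t + x k * t) * (A^-1)%g (1 - t * s)).
  rewrite -mulrA -(lauricella_resum _ _ _ _ xk) big_distrr /=.
  apply: eq_bigr => a _.
  rewrite /lauricella_weight mulchar_ext1 xk mul1r; ring.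
have liftE j : (lift k j == lift k j0) = (j == j0).
  by rewrite (inj_eq (@lift_inj _ k)).
under eq_bigr => f _ do rewrite sumE mulrCA mulrDr mulrDr.
rewrite big_split /=; congr (_ + _).
  under [X in lauricellaA _ X _ _]funext => j do rewrite liftE.
  under [X in lauricellaA _ _ _ X]funext => j do rewrite liftE.
  have /= reflect := @lauricellaA_reflect _ _ m A (fun j => B (lift k j))
    (fun j => C (lift k j)) (fun j => x (lift k j)) j0 xl.
  rewrite -[in RHS]mulrA -[in RHS]mulrA [_ * (_ * lauricellaA _ _ _ _)]mulrA.
  rewrite reflect.
  rewrite !big_distrr /=; apply: eq_bigr => f _; ring.
(* Making the sum over t outermost exposes, for each t, a series in the arguments x_i t. *)
rewrite !big_distrr /=.
under eq_bigr => f _ do rewrite !big_distrr /=.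
rewrite exchange_big /=; apply: eq_bigr => t _.
(* At t = 0 the weights for x_i t and x_i may differ, but A C_k^-1 vanishes there; for t != 0 they
   agree. *)
have [->|t0] := eqVneq t 0.
  rewrite (mulchar0 (A * (C k)^-1)%g) !mul0r mulr0.
  by apply: big1 => f _; rewrite !mul0r !mulr0.
rewrite lauricellaA_weight !big_distrr /=; apply: eq_bigr => f _.
under [in RHS]eq_bigr => j _.
  rewrite (@lauricella_weight_eps _ _ _ _ _ (x (lift k j))).
    over.
  by rewrite mulf_eq0 (negbTE t0) orbF.
have -> : \sum_(j < m) x (lift k j) * t * f j
  = t * \sum_(j < m) x (lift k j) * f j.
  by rewrite big_distrr; apply: eq_bigr => j _; rewrite /= mulrCA mulrA.
ring.
Qed.
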